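(* A transversal line field $\mathcal N$ on a punctured planar regular conic $C$ defines a projective billiard that is projectively equivalent to a space form billiard if and only if there exists a regular conic $S\neq C$ such that for every $Q\in C$ the complexified projective billiard reflection at $Q$ permutes the complex lines through $Q$ tangent to the complexified conic $S$.
   Context: A projective billiard is a smooth planar curve $C$ equipped with a transversal line field $\mathcal N$. The projective billiard reflection at $Q\in C$ acts on the space of lines through $Q$ as the affine involution that fixes the points of the tangent line to $C$ at $Q$, preserves the line $\mathcal N(Q)$ and acts on $\mathcal N(Q)$ as the central symmetry with respect to $Q$; it is complexified to an involution of the space of complex lines through $Q$. A punctured conic is a conic with a finite set of points removed. Two projective billiards are projectively equivalent if there is a projective transformation $\mathbb{RP}^2\to\mathbb{RP}^2$ sending one curve to the other and one structure to the other. Space form billiard: let $A\in\{\mathrm{diag}(1,1,0),\mathrm{diag}(1,1,1),\mathrm{diag}(1,1,-1)\}$, with homogeneous coordinates $[x_1:x_2:x_3]$ on $\mathbb{RP}^2$. The billiard $(C,\mathcal N)$ is a space form billiard with matrix $A$ if: for $A=\mathrm{diag}(1,1,0)$, $\mathcal N$ is the Euclidean normal line field to $C$ in the affine chart $\{x_3\neq0\}$, identified with the plane $\{x_3=1\}$; for $A=\mathrm{diag}(1,1,\pm1)$, for every $Q\in C$ the two-dimensional subspaces of $\mathbb R^3$ projected to the tangent line $T_QC$ and to $\mathcal N(Q)$ are orthogonal with respect to the scalar product $\langle Ax,x\rangle$.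
   Formalization: For A = diag(1,1,-1), a space form billiard is required not to have its curve C lying on the absolute <Ax,x>=0; there orthogonality holds for every transversal line field, so the ''only if'' part would fail. *)

(* Defs.v *)
From HB Require Import structures.
From mathcomp Require Import all_boot all_order all_algebra.
From mathcomp Require Import complex.
From mathcomp Require Import all_classical all_reals all_analysis.
Import Order.TTheory GRing.Theory Num.Theory.
Import numFieldNormedType.Exports.

Set Implicit Arguments.
Unset Strict Implicit.
Unset Printing Implicit Defensive.

Local Open Scope classical_set_scope.
Local Open Scope ring_scope.

(* Points of the projective plane over F are nonzero rows x : 'rV[F]_3, lines
   are nonzero columns l : 'cV[F]_3, both up to [proportional]; the point x lies
   on the line l when x *m l = 0. So l stands for the two-dimensional subspace
   {x | x *m l = 0} of F^3. An invertible g acts on points by x |-> x *m g,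
   hence on lines by l |-> invmx g *m l. *)
Definition proportional (F : fieldType) (m n : nat) (u v : 'M[F]_(m, n)) : Prop :=
  exists2 k : F, k != 0 & u = k *: v.

Definition conic_points (F : fieldType) (M : 'M[F]_3) (x : 'rV[F]_3) : Prop :=
  x != 0 /\ x *m M *m x^T = 0.

(* The kernel of the differential at x of the quadratic form of M (M symmetric,
   the factor 2 dropped). *)
Definition tangent_line (F : fieldType) (M : 'M[F]_3) (x : 'rV[F]_3) : 'cV[F]_3 :=
  M *m x^T.

Definition is_tangent (F : fieldType) (M : 'M[F]_3) (l : 'cV[F]_3) : Prop :=
  exists2 p : 'rV[F]_3, conic_points M p & proportional l (tangent_line M p).

(* A regular conic of RP^2: nondegenerate, with a nonempty real locus. *)
Definition regular_conic (R : realType) (M : 'M[R]_3) : Prop :=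
  [/\ M^T = M, M \in unitmx & exists x : 'rV[R]_3, conic_points M x].

Definition punctured_conic (R : realType) (M : 'M[R]_3) (P : seq 'rV[R]_3) :
    set 'rV[R]_3 :=
  [set x | conic_points M x /\ forall p, p \in P -> ~ proportional x p].

(* N x is a line through x other than the tangent line, depending only on the
   point of RP^2 given by x. Since columns matter only up to a scalar,
   continuity of the line field at x0 means that it has a representative n that
   is continuous at x0 along C. *)
Definition transversal_line_field (R : realType) (M : 'M[R]_3)
    (C : set 'rV[R]_3) (N : 'rV[R]_3 -> 'cV[R]_3) : Prop :=
  [/\ forall x, C x ->
        [/\ N x != 0, x *m N x = 0 & ~ proportional (N x) (tangent_line M x)],
      forall (x : 'rV[R]_3) (k : R), C x -> k != 0 ->
        proportional (N (k *: x)) (N x)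
    & forall x0, C x0 -> exists n : 'rV[R]_3 -> 'cV[R]_3,
        (forall x, C x -> proportional (n x) (N x)) /\
        n @ within C (nbhs x0) --> n x0].

Record conic_billiard (R : realType) := ConicBilliard {
  conic : 'M[R]_3;
  punctures : seq 'rV[R]_3;
  line_field : 'rV[R]_3 -> 'cV[R]_3;
  conic_regular : regular_conic conic;
  field_transversal :
    transversal_line_field conic (punctured_conic conic punctures) line_field
}.

Definition curve (R : realType) (B : conic_billiard R) : set 'rV[R]_3 :=
  punctured_conic (conic B) (punctures B).

Definition tangent (R : realType) (B : conic_billiard R) (x : 'rV[R]_3) :
    'cV[R]_3 :=
  tangent_line (conic B) x.

(* No condition on tangent lines is needed: a projective transformation that
   sends one curve to the other sends tangent lines to tangent lines. *)
Definition projectively_equivalent (R : realType) (B B' : conic_billiard R) : Prop :=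
  exists g : 'M[R]_3,
    [/\ g \in unitmx,
        forall x : 'rV[R]_3, curve B x <-> curve B' (x *m g)
      & forall x : 'rV[R]_3, curve B x ->
          proportional (line_field B' (x *m g)) (invmx g *m line_field B x)].

Definition diag11 (R : realType) (c : R) : 'M[R]_3 :=
  diag_mx (\row_(i < 3) if i == ord_max then c else 1).

(* In the plane x_3 = 1, the vectors parallel to the line t are the u with
   u_3 = 0 and u *m t = 0. *)
Definition euclidean_perpendicular (R : realType) (t n : 'cV[R]_3) : Prop :=
  forall u v : 'rV[R]_3, u 0 ord_max = 0 -> v 0 ord_max = 0 ->
    u *m t = 0 -> v *m n = 0 -> u *m v^T = 0.

(* Orthogonality of two planes of R^3: the orthogonal complement of one, with
   respect to <Ax,x>, is contained in the other (a symmetric relation when A is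
   symmetric and invertible). *)
Definition orthogonal_planes (R : realType) (A : 'M[R]_3) (t n : 'cV[R]_3) : Prop :=
  forall v : 'rV[R]_3,
    (forall u : 'rV[R]_3, u *m t = 0 -> u *m A *m v^T = 0) -> v *m n = 0.

(* For diag(1,1,-1) the curve must not lie on the absolute <Ax,x> = 0: the
   orthogonal complement of a plane tangent to this cone at x is the line of x,
   so that on the absolute every line field would be orthogonal to the curve.
   For diag(1,1,1) this requirement always holds. *)
Definition space_form_billiard (R : realType) (A : 'M[R]_3) (B : conic_billiard R) :
    Prop :=
  (A = diag11 0 /\
    forall x, curve B x ->
      x 0 ord_max != 0 /\ euclidean_perpendicular (tangent B x) (line_field B x))
  \/
  ((A = diag11 1 \/ A = diag11 (-1)) /\
   (exists2 x, curve B x & x *m A *m x^T != 0) /\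
   forall x, curve B x -> orthogonal_planes A (tangent B x) (line_field B x)).

(* Reflection at the point x with tangent line t and transversal line n. The
   affine chart is {y | y *m h = 1}, the complement of the line h, and f is the
   linear extension to R^3 of the affine involution: f preserves the chart,
   fixes t pointwise, and sends y in n, normalized by y *m h = x *m h, to its
   symmetric point x + x - y. Such an f exists and is unique for every h, and
   its action on lines through x does not depend on h. *)
Definition billiard_reflection (R : realType) (h : 'cV[R]_3) (x : 'rV[R]_3)
    (t n : 'cV[R]_3) (f : 'M[R]_3) : Prop :=
  [/\ f *m h = h,
      forall y : 'rV[R]_3, y *m t = 0 -> y *m f = y
    & forall y : 'rV[R]_3, y *m n = 0 -> y *m h = x *m h -> y *m f = x + x - y].

Definition complexify (R : realType) (m n : nat) (A : 'M[R]_(m, n)) :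
    'M[R[i]]_(m, n) :=
  map_mx (real_complex R) A.

(* The complexification of f permutes the complex lines through x tangent to the
   complexification of the conic S. *)
Definition permutes_tangents (R : realType) (S : 'M[R]_3) (x : 'rV[R]_3)
    (f : 'M[R]_3) : Prop :=
  forall l : 'cV[R[i]]_3, l != 0 -> complexify x *m l = 0 ->
    (is_tangent (complexify S) l <->
     is_tangent (complexify S) (invmx (complexify f) *m l)).

(* Main.v *)
(* Put D = S^-1, the dual conic. The complexified reflection at x has the tangent
   line t and the line n of the field as fixed lines, so it permutes the zeros of
   D in the pencil of lines through x iff n^T D t = 0, unless t itself is tangent
   to S; by continuity the exceptional points do not matter. Since
   n^T M^-1 t = 0 always holds for the conic M of the billiard, this condition
   depends on D only modulo M^-1. A space form billiard satisfies it with D = A,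
   up to a projective transformation, and A + l M^-1 is the dual of a regular
   conic for large l. Conversely S, being indefinite and nondegenerate, is
   projectively diag(1,1,-1) up to a scalar, which makes the billiard a space form
   billiard with A = diag(1,1,-1). *)
Require Import Defs.
From mathcomp Require Import all_boot all_order all_algebra.
From mathcomp Require Import ring lra complex polyrcf.
From mathcomp Require Import all_classical all_reals all_analysis.
Import Order.TTheory GRing.Theory Num.Theory.
Import numFieldNormedType.Exports.

Set Implicit Arguments.
Unset Strict Implicit.
Unset Printing Implicit Defensive.

Local Open Scope classical_set_scope.
Local Open Scope ring_scope.

(** * Bilinear forms given by matrices *)

Definition bilin (F : fieldType) (n : nat) (K : 'M[F]_n) (u v : 'rV[F]_n) : F :=
  (u *m K *m v^T) 0 0.

Section Bilin.
Variables (F : fieldType) (n : nat).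
Implicit Types (K : 'M[F]_n) (u v w : 'rV[F]_n) (a : F).

Lemma mx11_eq0 (A : 'M[F]_1) : (A == 0) = (A 0 0 == 0).
Proof.
apply/eqP/eqP => [->|h]; first by rewrite mxE.
by apply/matrixP => i j; rewrite !ord1 h mxE.
Qed.

Lemma bilin_eq0 K u v : (u *m K *m v^T == 0) = (bilin K u v == 0).
Proof. exact: mx11_eq0. Qed.

Lemma bilinDl K u v w : bilin K (u + v) w = bilin K u w + bilin K v w.
Proof. by rewrite /bilin !mulmxDl mxE. Qed.

Lemma bilinDr K u v w : bilin K u (v + w) = bilin K u v + bilin K u w.
Proof. by rewrite /bilin linearD mulmxDr mxE. Qed.

Lemma bilinZl K a u v : bilin K (a *: u) v = a * bilin K u v.
Proof. by rewrite /bilin -!scalemxAl mxE. Qed.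

Lemma bilinZr K a u v : bilin K u (a *: v) = a * bilin K u v.
Proof. by rewrite /bilin linearZ -scalemxAr mxE. Qed.

Lemma bilinC K u v : K^T = K -> bilin K u v = bilin K v u.
Proof.
move=> Ks; rewrite /bilin -[u in LHS]trmxK -[K in LHS]Ks -trmx_mul -trmx_mul mxE.
by rewrite mulmxA.
Qed.

Lemma bilin_mull K (g : 'M[F]_n) u v : bilin K (u *m g) v = bilin (g *m K) u v.
Proof. by rewrite /bilin !mulmxA. Qed.

Lemma bilin_mulr K (g : 'M[F]_n) u v : bilin K u (v *m g) = bilin (K *m g^T) u v.
Proof. by rewrite /bilin trmx_mul !mulmxA. Qed.

Lemma bilinDmx K L u v : bilin (K + L) u v = bilin K u v + bilin L u v.
Proof. by rewrite /bilin mulmxDr mulmxDl mxE. Qed.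

Lemma bilinZmx K a u v : bilin (a *: K) u v = a * bilin K u v.
Proof. by rewrite /bilin -scalemxAr -scalemxAl mxE. Qed.
End Bilin.

Definition bilinE := (bilinDl, bilinDr, bilinZl, bilinZr).

(** * Frames of the plane adapted to a conic *)

Definition frame (F : fieldType) (x d e : 'rV[F]_3) : 'M[F]_3 :=
  \matrix_(i < 3) (if i == 0 :> nat then x else if i == 1 :> nat then d else e).

Section Frame.
Variable F : fieldType.
Implicit Types (K M : 'M[F]_3) (x d e : 'rV[F]_3) (c : F).

Lemma frame_gram K x d e (i j : 'I_3) :
  (frame x d e *m K *m (frame x d e)^T) i j =
  bilin K (row i (frame x d e)) (row j (frame x d e)).
Proof.
by rewrite /bilin -row_mul tr_row mxE [RHS]mxE; apply: eq_bigr => k _;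
  rewrite [row _ _ _ _]mxE [col _ _ _ _]mxE.
Qed.

Lemma mul_frame (r : 'rV[F]_3) x d e :
  r *m frame x d e = r 0 0 *: x + r 0 1 *: d + r 0 (inord 2) *: e.
Proof.
apply/matrixP => i j; rewrite !mxE !big_ord_recl big_ord0 addr0 ord1 !mxE addrA.
have -> : lift ord0 ord0 = 1 :> 'I_3 by exact: val_inj.
have -> : lift ord0 (lift ord0 ord0) = inord 2 :> 'I_3.
  by apply: val_inj; rewrite /= inordK.
by rewrite /= inordK.
Qed.

(* The Gram matrix of M in the frame (x, d, e) is [[0,0,1],[0,c,0],[1,0,0]]. *)
Definition adapted_frame M x d e c :=
  [/\ bilin M x x = 0, bilin M x d = 0, bilin M d e = 0 &
   [/\ bilin M e e = 0, bilin M x e = 1, bilin M d d = c, c != 0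
     & frame x d e \in unitmx]].

(** The six values fill the upper triangle of the Gram matrix in the basis (x, d, e); symmetry
    supplies the rest and the invertible frame cancels. *)
Lemma bilin_ext K M x d e : K^T = K -> M^T = M -> frame x d e \in unitmx ->
  bilin K x x = bilin M x x -> bilin K x d = bilin M x d ->
  bilin K x e = bilin M x e -> bilin K d d = bilin M d d ->
  bilin K d e = bilin M d e -> bilin K e e = bilin M e e -> K = M.
Proof.
move=> Ks Ms fu h1 h2 h3 h4 h5 h6.
have fuT : (frame x d e)^T \in unitmx by rewrite unitmx_tr.
suff h : frame x d e *m K *m (frame x d e)^T = frame x d e *m M *m (frame x d e)^T.
  move: h => /(congr1 (mulmx^~ (invmx (frame x d e)^T))); rewrite !mulmxK //.
  by move=> /(congr1 (mulmx (invmx (frame x d e)))); rewrite !mulKmx.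
apply/matrixP => i j; rewrite !frame_gram.
case: i => [[|[|[|//]]] ?]; case: j => [[|[|[|//]]] ?]; rewrite /frame !rowK /= //.
- by rewrite bilinC // h2 bilinC.
- by rewrite bilinC // h3 bilinC.
- by rewrite bilinC // h5 bilinC.
Qed.
End Frame.

(** The isotropic vector x completes to a hyperbolic pair (x, e), and d spans the orthogonal
    complement of that plane. *)
Lemma adapted_frame_exists (F : numFieldType) (M : 'M[F]_3) (x : 'rV[F]_3) :
  M^T = M -> M \in unitmx -> conic_points M x ->
  exists d e c, adapted_frame M x d e c.
Proof.
move=> Ms Mu [x0 /eqP]; rewrite bilin_eq0 => /eqP xx.
have [e1 xe1] : exists e, bilin M x e != 0.
  apply: contrapT => /forallNP h; move/eqP: x0; apply.
  apply/(can_inj (mulmxK Mu)); rewrite mul0mx; apply/matrixP => i j.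
  rewrite [RHS]mxE ord1; have /negP/negPn/eqP := h (delta_mx 0 j).
  by rewrite /bilin trmx_delta -colE mxE.
have [e2 xe2] : exists e2, bilin M x e2 = 1.
  by exists ((bilin M x e1)^-1 *: e1); rewrite bilinZr mulVf.
(* Adding a multiple of the isotropic x leaves the pairing with x equal to 1 and can be tuned to
   make e isotropic. *)
have [e xe ee] : exists2 e, bilin M x e = 1 & bilin M e e = 0.
  exists (e2 + (- (bilin M e2 e2 / 2)) *: x).
    by rewrite !bilinE xx xe2 mulr0 addr0.
  by rewrite !bilinE xx xe2 (bilinC e2 x Ms) xe2; field.
(* Two linear conditions on a space of dimension three have a nonzero solution. *)
have [d d0 [dx de]] : exists2 d, d != 0 & bilin M d x = 0 /\ bilin M d e = 0.
  pose K : 'M[F]_(3, 1 + 1) := row_mx (M *m x^T) (M *m e^T).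
  have k0 : kermx K != 0.
    rewrite -mxrank_eq0 mxrank_ker -lt0n subn_gt0.
    by apply: leq_ltn_trans (rank_leq_col _) _.
  exists (nz_row (kermx K)); first by rewrite nz_row_eq0.
  have /sub_kermxP := nz_row_sub (kermx K).
  rewrite mul_mx_row !mulmxA -[0 in RHS]row_mx0 => /eq_row_mx [h1 h2].
  by rewrite /bilin h1 h2 mxE.
(* Pairing a vanishing combination with x and with e isolates the coefficients of e and of x. *)
have fu : frame x d e \in unitmx.
  rewrite -row_free_unit; apply/inj_row_free => r.
  rewrite mul_frame => h.
  have r2 : r 0 (inord 2) = 0.
    have := congr1 (fun y => bilin M y x) h; rewrite !bilinE xx dx (bilinC e x Ms) xe.
    by rewrite /bilin !mul0mx mxE !mulr0 !add0r mulr1.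
  have r0 : r 0 0 = 0.
    have := congr1 (fun y => bilin M y e) h; rewrite !bilinE ee de xe.
    by rewrite /bilin !mul0mx mxE !mulr0 !addr0 mulr1.
  move: h; rewrite r0 r2 !scale0r add0r addr0 => /eqP.
  rewrite scaler_eq0 (negbTE d0) orbF => /eqP r1.
  apply/matrixP => i j; rewrite ord1 [RHS]mxE.
  case: j => [[|[|[|//]]] p]; [rewrite -r0|rewrite -r1|rewrite -r2];
   congr (r 0 _); apply: val_inj => //=; by rewrite inordK.
(* An isotropic d would be orthogonal to the whole frame, against nondegeneracy. *)
have dd : bilin M d d != 0.
  apply/eqP => dd; move/eqP: d0; apply.
  apply/(can_inj (mulmxK Mu)); rewrite mul0mx.
  have fuT : (frame x d e)^T \in unitmx by rewrite unitmx_tr.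
  apply/(can_inj (mulmxK fuT)); rewrite mul0mx.
  apply/matrixP => i j; rewrite ord1 [RHS]mxE.
  have -> : (d *m M *m (frame x d e)^T) 0 j = bilin M d (row j (frame x d e)).
    by rewrite /bilin !mxE; apply: eq_bigr => k _; rewrite !mxE.
  by case: j => [[|[|[|//]]] p]; rewrite rowK.
exists d, e, (bilin M d d); split => //; first by rewrite bilinC.
Qed.

(** * Limits of matrices, entry by entry *)

Section MatrixLimits.
Variables (R : realType) (T : Type) (F : set_system T).
Hypothesis FF : Filter F.

Lemma cvg_mx m n (f : T -> 'M[R]_(m, n)) (A : 'M[R]_(m, n)) :
  (forall i j, (fun s => f s i j) @ F --> A i j) -> f @ F --> A.
Proof.
move=> h U [P PA sPU]; rewrite /nbhs /=.
have : F [set s | forall i j, P i j (f s i j)].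
  by apply: filter_forall => i; apply: filter_forall => j; exact: h (PA i j).
by apply: filterS => s /= hs; exact: sPU.
Qed.

Lemma cvg_coord m n (f : T -> 'M[R]_(m, n)) (A : 'M[R]_(m, n)) i j :
  f @ F --> A -> (fun s => f s i j) @ F --> A i j.
Proof.
move=> h; have ci := @coord_continuous R m n i j A.
exact: (@continuous_cvg T _ _ F FF f (fun B => B i j) A ci h).
Qed.

Lemma cvg_mulmx m n p (f : T -> 'M[R]_(m, n)) (g : T -> 'M[R]_(n, p))
    (A : 'M[R]_(m, n)) (B : 'M[R]_(n, p)) :
  f @ F --> A -> g @ F --> B -> (fun s => f s *m g s) @ F --> A *m B.
Proof.
move=> fA gB; apply: cvg_mx => i j; rewrite mxE.
under eq_fun do rewrite mxE.
apply: cvg_big => [|k _]; first exact: add_continuous.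
by apply: cvgM; apply: cvg_coord.
Qed.

Lemma cvg_trmx m n (f : T -> 'M[R]_(m, n)) (A : 'M[R]_(m, n)) : f @ F --> A ->
  (fun s => (f s)^T) @ F --> A^T.
Proof.
by move=> fA; apply: cvg_mx => i j; rewrite mxE;
  under eq_fun do rewrite mxE; exact: cvg_coord.
Qed.
End MatrixLimits.

(** * Points of a punctured conic near a given point of the conic *)

Section NearPoints.
Variable R : realType.
Implicit Types (K M : 'M[R]_3) (x : 'rV[R]_3).

Lemma near_dnbhs_notin (a : R) (l : seq R) : \forall s \near a^', s \notin l.
Proof.
elim: l => [|b l ih]; first by near=> s.
have hb : \forall s \near a^', s != b.
  have [->|ab] := eqVneq b a; first exact: nbhs_dnbhs_neq.
  have h : (fun s => s - b) @ a --> a - b by apply: cvgB => //; exact: cvg_cst.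
  apply: nbhs_dnbhs; have := cvgr_neq0 _ h; rewrite subr_eq0 eq_sym => /(_ _ ab).
  by apply: filterS => s; rewrite subr_eq0.
near=> s; rewrite inE negb_or; apply/andP; split; first by near: s.
by near: s.
Unshelve. all: by end_near. Qed.

Lemma near_dnbhs_horner_neq0 (a : R) (w : {poly R}) : w != 0 ->
  \forall s \near a^', w.[s] != 0.
Proof.
move=> w0; apply: filterS (near_dnbhs_notin a (rootsR w)) => s; apply: contraNneq.
by move=> ws; rewrite -(roots_on_rootsR w0) in_itv /= rootE ws.
Qed.

(* x + s d - (c s^2 / 2) e parametrizes the conic in an adapted frame (x, d, e);
   restricted to this curve, a quadratic form is a polynomial of degree at most
   four in s, which vanishes only for the multiples of M. *)
Lemma punctured_conic_near M (P : seq 'rV[R]_3) x :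
  M^T = M -> M \in unitmx -> conic_points M x ->
  exists p : R -> 'rV[R]_3, [/\ p @ 0^' --> x,
    \forall s \near 0^', punctured_conic M P (p s)
    & forall K, K^T = K -> (forall k, K <> k *: M) ->
        \forall s \near 0^', p s *m K *m (p s)^T != 0].
Proof.
move=> Ms Mu Mx; have [x0 _] := Mx.
have [d [e [c [xx xd de [ee xe dd c0 fu]]]]] := adapted_frame_exists Ms Mu Mx.
pose p (s : R) := x + s *: d + (- (c * s ^+ 2 / 2)) *: e.
have pE K s : K^T = K -> bilin K (p s) (p s) = bilin K x x + 2 * bilin K x d * s
    + (bilin K d d - c * bilin K x e) * s ^+ 2 - c * bilin K d e * s ^+ 3
    + c ^+ 2 / 4 * bilin K e e * s ^+ 4.
  move=> Ks; rewrite !bilinE (bilinC d x Ks) (bilinC e x Ks) (bilinC e d Ks).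
  by field.
have pe s : bilin M (p s) e = 1 by rewrite !bilinE xe de ee; ring.
have pd s : bilin M (p s) d = s * c.
  by rewrite !bilinE xd dd (bilinC e d Ms) de; ring.
exists p; split.
- have : p @ 0 --> p 0.
    apply: cvgD.
      by apply: cvgD; [exact: cvg_cst|apply: cvgZ; [|exact: cvg_cst]].
    apply: cvgZ; last exact: cvg_cst.
    apply: cvgN; apply: cvgM; last exact: cvg_cst.
    by apply: cvgM; [exact: cvg_cst|exact: exprn_continuous].
  rewrite {2}/p scale0r addr0 expr0n mulr0 mul0r oppr0 scale0r addr0.
  by apply: cvg_trans; apply: cvg_app; exact: nbhs_dnbhs.
(* The pairings of p(s) with d and e are s c and 1, so s is recovered from the projective point and
   each puncture excludes one value. If q pairs to 0 with e, the quotient is 0 by convention, a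
   value that the punctured neighbourhood omits anyway. *)
- have := near_dnbhs_notin 0 [seq bilin M q d / bilin M q e / c | q <- P].
  apply: filterS => s sP; split.
    split; last first.
      by apply/eqP; rewrite bilin_eq0 pE // xx xd de ee xe dd; apply/eqP; ring.
    apply/eqP => ps; have := pe s; rewrite ps /bilin !mul0mx mxE => /esym/eqP.
    by rewrite oner_eq0.
  move=> q qP [k k0 pq]; move/negP: sP; apply; apply/mapP; exists q => //.
  have := pe s; have := pd s; rewrite pq !bilinZl => h1 h2.
  have q0 : bilin M q e != 0.
    by apply/eqP => h; move/eqP: h2; rewrite h mulr0 eq_sym oner_eq0.
  rewrite -[s](mulfK c0) -h1; congr (_ / _).
  by apply: (mulIf q0); rewrite divfK // mulrAC h2 mul1r.
- move=> K Ks Kn.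
  pose w := Poly [:: bilin K x x; 2 * bilin K x d; bilin K d d - c * bilin K x e;
    - (c * bilin K d e); c ^+ 2 / 4 * bilin K e e].
  have w0 : w != 0.
    (* Since [bilin M x e] is 1, the factor can only be [bilin K x e]; the five coefficients give
       the other Gram entries. *)
    apply/eqP => w0; apply: (Kn (bilin K x e)).
    have wi i : w`_i = 0 by rewrite w0 coef0.
    have := wi 0; have := wi 1; have := wi 2; have := wi 3; have := wi 4.
    rewrite !coef_Poly /= => h4 h3 h2 h1 h0.
    apply: (bilin_ext (x := x) (d := d) (e := e)) => //.
    + by rewrite linearZ /= Ms.
    + by rewrite bilinZmx xx h0 mulr0.
    + by rewrite bilinZmx xd mulr0; lra.
    + by rewrite bilinZmx xe mulr1.
    + by rewrite bilinZmx dd mulrC; apply/eqP; rewrite -subr_eq0 h2.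
    + rewrite bilinZmx de mulr0; move/eqP: h3.
      by rewrite oppr_eq0 mulf_eq0 (negbTE c0) => /eqP.
    + rewrite bilinZmx ee mulr0; move/eqP: h4.
      rewrite mulf_eq0 => /orP[|/eqP //].
      by rewrite mulf_eq0 expf_eq0 /= (negbTE c0) invr_eq0 pnatr_eq0.
  apply: filterS (near_dnbhs_horner_neq0 0 w0) => s.
  rewrite bilin_eq0 pE // horner_Poly /= => h.
  apply: contra_neq h => h; rewrite -[RHS]h; ring.
Unshelve. all: by end_near. Qed.

(** Any other form is nonzero at points of the curve arbitrarily close to a point of the conic, so
    finitely many punctures lose no information. *)
Lemma punctured_conic_form_scale M (P : seq 'rV[R]_3) K :
  regular_conic M -> K^T = K ->
  (forall x, punctured_conic M P x -> x *m K *m x^T = 0) ->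
  exists k, K = k *: M.
Proof.
move=> [Ms Mu [x Mx]] Ks h; apply: contrapT => /forallNP Kn.
have [p [_ pP /(_ K Ks Kn) pK]] := punctured_conic_near P Ms Mu Mx.
suff [s [ps]] : exists s, punctured_conic M P (p s) /\ p s *m K *m (p s)^T != 0.
  by rewrite h // eqxx.
by apply: (@filter_ex R 0^'); apply: filterI.
Qed.
End NearPoints.

(** * The pencil of lines through a point, reflections and tangency *)

Section Pencil.
Variables (F : fieldType) (x : 'rV[F]_3) (t n h : 'cV[F]_3).
Hypotheses (n0 : n != 0) (t0 : t != 0) (nt : ~ proportional n t).
Hypotheses (xt : x *m t = 0) (xn : x *m n = 0) (xh : x *m h != 0).

Let T : 'M[F]_3 := row_mx (row_mx t n) h.

(** The lines t and n are distinct and pass through x while h misses x, so the three columns are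
    independent. A row can then be prescribed and recognized by its values on t, n and h. *)
Lemma pencil_unitmx : T \in unitmx.
Proof.
rewrite -unitmx_tr -row_free_unit; apply/inj_row_free => r.
rewrite -[r in r *m _]trmxK -trmx_mul => /(congr1 trmx); rewrite trmxK trmx0.
(* The coefficients are split along the blocks of [T], which turns the product into a combination of
   t, n and h. *)
have -> : r^T = col_mx (col_mx ((r 0 0)%:M : 'M[F]_1) ((r 0 1)%:M : 'M[F]_1))
                       ((r 0 (inord 2))%:M : 'M[F]_1).
  apply/matrixP => i j; rewrite ord1 !mxE.
  case: splitP => [k|k] ik; rewrite !mxE; last first.
    rewrite [k]ord1 eqxx mulr1n; congr (r 0 _); apply: val_inj.
    by rewrite /= ik inordK // ord1.
  case: splitP => [l|l] kl; rewrite !mxE [l]ord1 eqxx mulr1n; congr (r 0 _);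
    by apply: val_inj; rewrite /= ik kl ord1.
move=> E; have {E} : (row_mx (row_mx t n) h : 'M[F]_(3, 1 + 1 + 1)) *m
  col_mx (col_mx (r 0 0)%:M (r 0 1)%:M) (r 0 (inord 2))%:M = 0 by exact: E.
rewrite !mul_row_col !mul_mx_scalar => E.
have r2 : r 0 (inord 2) = 0.
  move: (congr1 (mulmx x) E); rewrite !mulmxDr -!scalemxAr xt xn !scaler0 !add0r.
  by rewrite mulmx0 => /eqP; rewrite scaler_eq0 (negbTE xh) orbF => /eqP.
move: E; rewrite r2 scale0r addr0 => E.
have r1 : r 0 1 = 0.
  apply/eqP/negP => /negP r1; case: nt.
  have nE : n = (- (r 0 0 / r 0 1)) *: t.
    apply/(scalerI r1); rewrite scalerA mulrN mulrC divfK //; apply/eqP.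
    by rewrite scaleNr -addr_eq0 addrC E.
  exists (- (r 0 0 / r 0 1)) => //; apply: contra_neq n0 => k0.
  by rewrite nE k0 scale0r.
move: E => /eqP; rewrite r1 scale0r addr0 scaler_eq0 (negbTE t0) orbF => /eqP r0.
apply/matrixP => i j; rewrite ord1 [RHS]mxE.
by case: j => [[|[|[|//]]] p]; [rewrite -r0|rewrite -r1|rewrite -r2];
   congr (r 0 _); apply: val_inj => //=; rewrite inordK.
Qed.

Lemma pencil_ext (y z : 'rV[F]_3) :
  y *m t = z *m t -> y *m n = z *m n -> y *m h = z *m h -> y = z.
Proof.
move=> yt yn yh; apply: (can_inj (mulmxK pencil_unitmx)).
suff : y *m (row_mx (row_mx t n) h : 'M[F]_(3, 1 + 1 + 1)) =
  z *m (row_mx (row_mx t n) h : 'M[F]_(3, 1 + 1 + 1)) by [].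
by rewrite !mul_mx_row yt yn yh.
Qed.

Lemma pencil_solve (a b c : 'M[F]_1) :
  exists y : 'rV[F]_3, [/\ y *m t = a, y *m n = b & y *m h = c].
Proof.
pose r : 'rV[F]_3 := row_mx (row_mx a b) c.
exists (r *m invmx T); have : r *m invmx T *m
    (row_mx (row_mx t n) h : 'M[F]_(3, 1 + 1 + 1)) = row_mx (row_mx a b) c.
  exact: mulmxKV pencil_unitmx _.
rewrite !mul_mx_row => /eq_row_mx [/eq_row_mx [-> ->] ->]; split => //.
Qed.

End Pencil.

(* w is fixed by its values on t, n and h, the last being w *m h = 0. *)
Lemma billiard_reflectionE (R : realType) (h : 'cV[R]_3) (x : 'rV[R]_3)
    (t n : 'cV[R]_3) (f : 'M[R]_3) :
  n != 0 -> t != 0 -> ~ proportional n t ->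
  x *m t = 0 -> x *m n = 0 -> x *m h != 0 ->
  billiard_reflection h x t n f <->
  exists w : 'rV[R]_3, [/\ f = 1%:M + t *m w, w *m t = (- 2)%:M, w *m n = 0
                         & w *m h = 0].
Proof.
move=> n0 t0 nt xt xn xh; split=> [[fh ft fn]|[w [-> wt wn wh]]].
  (* This y lies on n, off t, at the same chart level as x. So f sends it to 2x - y, which together
     with the identity on t determines f and forces w = 2(x - y). *)
  have [y [yt yn yh]] := pencil_solve n0 t0 nt xt xn xh 1%:M 0 (x *m h).
  exists (2 *: (x - y)); split.
  - apply/row_matrixP => i; rewrite !rowE; set z := delta_mx 0 i.
    (* Subtracting the right multiple of y brings a basis row z onto t, where f is the identity. *)
    have : (z - z *m t *m y) *m f = z - z *m t *m y.
      by apply: ft; rewrite mulmxBl -(mulmxA (z *m t)) yt mulmx1 subrr.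
    rewrite mulmxBl -(mulmxA (z *m t)) (fn y) // => /(canRL (subrK _)) ->.
    rewrite mulmxDr mulmx1 -addrA; congr (_ + _).
    rewrite !mulmxA -scalemxAr -mulmxN -mulmxDr scalemxAr; congr (_ *m _).
    by rewrite scalerBr !scaler_nat !mulr2n opprD addrCA addrC -!addrA.
  - by rewrite -scalemxAl mulmxBl xt yt sub0r scalerN scale_scalar_mx mulr1 raddfN.
  - by rewrite -scalemxAl mulmxBl xn yn subrr scaler0.
  - by rewrite -scalemxAl mulmxBl yh subrr scaler0.
split.
- by rewrite mulmxDl mul1mx -mulmxA wh mulmx0 addr0.
- by move=> y yt; rewrite mulmxDr mulmx1 mulmxA yt mul0mx addr0.
- move=> y yn yh; rewrite mulmxDr mulmx1; apply: (pencil_ext n0 t0 nt xt xn xh).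
  + rewrite mulmxDl -!mulmxA wt mul_mx_scalar mulmxBl mulmxDl xt !add0r.
    rewrite -scalemxAr scaleNr scaler_nat mulr2n.
    by rewrite opprD addrA subrr add0r.
  + by rewrite mulmxDl -!mulmxA wn !mulmx0 addr0 mulmxBl mulmxDl xn yn !addr0 subrr.
  + by rewrite mulmxDl -!mulmxA wh !mulmx0 addr0 mulmxBl mulmxDl yh addrK.
Qed.

(** The pole of l, the row l^T S^-1, is up to a scalar the only candidate for the point of tangency,
    and it lies on S exactly when the dual form vanishes at l. *)
Lemma is_tangentE (F : fieldType) (S : 'M[F]_3) (l : 'cV[F]_3) :
  S^T = S -> S \in unitmx -> l != 0 ->
  is_tangent S l <-> l^T *m invmx S *m l = 0.
Proof.
move=> Ss Su l0; have Sis : (invmx S)^T = invmx S by rewrite trmx_inv Ss.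
split=> [[p [p0 pS] [k k0 ->]]|lS].
  rewrite /tangent_line [(_ *: _)^T]linearZ /= trmx_mul trmxK Ss -!scalemxAl -!scalemxAr.
  by rewrite mulmxA (mulmxK Su) pS !scaler0.
exists (l^T *m invmx S); last first.
  by exists 1; rewrite ?oner_eq0 // scale1r /tangent_line trmx_mul trmxK Sis mulKVmx.
split; last by rewrite trmx_mul trmxK Sis mulmxKV // mulmxA.
apply: contra_neq l0 => /(congr1 (mulmx^~ S)); rewrite mulmxKV // mul0mx.
by move=> /(congr1 trmx); rewrite trmxK trmx0.
Qed.

(** If b were nonzero there would be a nonzero root z; subtracting the equations at z and -z leaves
    4zb = 0. *)
Lemma linear_coef_eq0 (C : numClosedFieldType) (a b c : C) : a != 0 ->
  (forall z, z ^+ 2 * a + 2 * z * b + c = 0 ->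
             (- z) ^+ 2 * a + 2 * - z * b + c = 0) -> b = 0.
Proof.
move=> a0 h; apply/eqP/negP => /negP b0.
(* Of the two square roots of the reduced discriminant, one that differs from b is chosen, so that
   the root (s - b) / a is nonzero. *)
have [s ss sb] : exists2 s, s ^+ 2 = b ^+ 2 - a * c & s - b != 0.
  have [e|ne] := eqVneq (sqrtC (b ^+ 2 - a * c)) b; last first.
    by exists (sqrtC (b ^+ 2 - a * c)); rewrite ?sqrtCK // subr_eq0.
  exists (- b); first by rewrite sqrrN -{1}e sqrtCK.
  by rewrite -opprD oppr_eq0 -mulr2n mulrn_eq0.
have cE : c = (b ^+ 2 - s ^+ 2) / a by rewrite ss; field.
have zE : ((s - b) / a) ^+ 2 * a + 2 * ((s - b) / a) * b + c = 0.
  by rewrite cE; field.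
have := h _ zE; rewrite -zE => /eqP; rewrite -subr_eq0.
rewrite (_ : _ - _ = - (4 * ((s - b) / a * b))); last by ring.
by rewrite oppr_eq0 !mulf_eq0 invr_eq0 pnatr_eq0 (negbTE sb) (negbTE a0) (negbTE b0).
Qed.

(** * Reflections that permute the tangents of a conic *)

Section PermutesTangents.
Variables (R : realType) (S : 'M[R]_3) (x : 'rV[R]_3) (t n h : 'cV[R]_3).
Hypotheses (Ss : S^T = S) (Su : S \in unitmx).
Hypotheses (n0 : n != 0) (t0 : t != 0) (nt : ~ proportional n t).
Hypotheses (xt : x *m t = 0) (xn : x *m n = 0) (xh : x *m h != 0).

Let cS_sym : (complexify S)^T = complexify S.
Proof. by rewrite /complexify matrix.map_trmx Ss. Qed.

Let cS_unit : complexify S \in unitmx.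
Proof. by rewrite map_unitmx. Qed.

Let Si_sym : (invmx S)^T = invmx S.
Proof. by rewrite trmx_inv Ss. Qed.

Lemma reflection_invol (w : 'rV[R]_3) : w *m t = (- 2)%:M ->
  (1%:M + t *m w) *m (1%:M + t *m w) = 1%:M.
Proof.
move=> wt; have AA : t *m w *m (t *m w) = - (t *m w *+ 2).
  rewrite -mulmxA (mulmxA w) wt mul_scalar_mx -scalemxAr scaleNr.
  by rewrite scaler_nat.
by rewrite mulmxDr mulmx1 mulmxDl mul1mx AA -addrA addrA -addrA [X in _ + X]addrA
  -mulr2n subrr addr0.
Qed.

Lemma reflection_inv (w : 'rV[R]_3) : w *m t = (- 2)%:M ->
  invmx (complexify (1%:M + t *m w)) = complexify (1%:M + t *m w).
Proof.
move=> /reflection_invol ff; have [fu _] := mulmx1_unit ff.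
rewrite /complexify -map_invmx; congr map_mx.
by apply: (can_inj (mulKmx fu)); rewrite mulmxV // ff.
Qed.

(** With D = S^-1, the reflection replaces l by l + (w l) t and changes l^T D l by (w l)(2 t^T D +
    (t^T D t) w) l. The row in the second bracket is a multiple of x, which kills the lines through
    x, so the dual form is preserved on the pencil. *)
Lemma orthogonal_permutes_tangents f :
  n^T *m invmx S *m t = 0 -> billiard_reflection h x t n f -> permutes_tangents S x f.
Proof.
move=> nSt /(billiard_reflectionE _ n0 t0 nt xt xn xh) [w [-> wt wn wh]] l l0 xl.
rewrite reflection_inv //.
have fl0 : complexify (1%:M + t *m w) *m l != 0.
  apply: contra_neq l0 => /(congr1 (mulmx (complexify (1%:M + t *m w)))).
  rewrite mulmx0 mulmxA -map_mxM reflection_invol //.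
  by rewrite map_mx1 mul1mx.
rewrite !is_tangentE //.
suff -> : (complexify (1%:M + t *m w) *m l)^T *m invmx (complexify S) *m
  (complexify (1%:M + t *m w) *m l) = l^T *m invmx (complexify S) *m l by [].
(* The row vanishes on t because w t = -2 and on n by conjugacy, as x does; the values on h fix the
   factor. *)
have [k kx] : exists k, 2 *: (t^T *m invmx S) + (t^T *m invmx S *m t) *m w = k *: x.
  exists (((2 *: (t^T *m invmx S)) *m h) 0 0 / (x *m h) 0 0).
  apply: (pencil_ext n0 t0 nt xt xn xh).
  - rewrite mulmxDl -[X in X + _]scalemxAl -(mulmxA _ w) wt mul_mx_scalar scaleNr subrr.
    by rewrite -[RHS]scalemxAl xt scaler0.
  - rewrite mulmxDl -[X in X + _]scalemxAl -(mulmxA _ w) wn mulmx0 addr0.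
    rewrite -[RHS]scalemxAl xn scaler0.
    move: nSt => /(congr1 trmx); rewrite trmx0 !trmx_mul trmxK Si_sym mulmxA => ->.
    by rewrite scaler0.
  - rewrite mulmxDl -[in LHS](mulmxA _ w) wh mulmx0 addr0 -(scalemxAl _ x h).
    apply/matrixP => i j; rewrite !ord1 [RHS]mxE divfK //.
    by rewrite -mx11_eq0.
rewrite /complexify -map_invmx.
rewrite map_mxD map_mx1 map_mxM mulmxDl mul1mx.
set D := map_mx _ (invmx S); set ct := map_mx _ t; set cw := map_mx _ w.
have cE : (2 *: (ct^T *m D) + (ct^T *m D *m ct) *m cw) *m l = 0.
  have := congr1 (fun u => map_mx (real_complex R) u *m l) kx.
  rewrite map_mxD !map_mxZ !map_mxM -matrix.map_trmx -/D -/ct -/cw rmorph_nat => ->.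
  by rewrite -scalemxAl xl scaler0.
have Ds : D^T = D by rewrite /D matrix.map_trmx Si_sym.
have -> : ct *m cw *m l = ((cw *m l) 0 0) *: ct.
  by rewrite -mulmxA {1}[cw *m l]mx11_scalar mul_mx_scalar.
set a := (cw *m l) 0 0.
have lt : l^T *m D *m ct = ct^T *m D *m l.
  by rewrite [LHS]mx11_scalar -tr_scalar_mx -mx11_scalar !trmx_mul trmxK Ds mulmxA.
rewrite [(l + _)^T]linearD /= [(a *: ct)^T]linearZ /=.
rewrite !mulmxDl !mulmxDr -!scalemxAl -!scalemxAr lt.
rewrite -!addrA -[RHS]addr0; congr (_ + _).
transitivity (a *: ((2 *: (ct^T *m D) + (ct^T *m D *m ct) *m cw) *m l));
  last by rewrite cE scaler0.
rewrite mulmxDl -(scalemxAl _ _ l) -(mulmxA _ cw) [cw *m l]mx11_scalar -/a mul_mx_scalar.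
by rewrite scalerDr scaler_nat mulr2n scalerDr addrA.
Qed.

(** On the lines a t + n of the pencil the reflection is a -> -a, and tangency to S is a quadratic
    equation in a. Its complex root set is symmetric, so the middle coefficient, twice the required
    pairing, vanishes. *)
Lemma permutes_tangents_orthogonal :
  t^T *m invmx S *m t != 0 ->
  (forall f, billiard_reflection h x t n f -> permutes_tangents S x f) ->
  n^T *m invmx S *m t = 0.
Proof.
move=> tSt perm.
have [w [wt wn wh]] := pencil_solve n0 t0 nt xt xn xh (- 2)%:M 0 0.
have /perm : billiard_reflection h x t n (1%:M + t *m w).
  by apply/(billiard_reflectionE _ n0 t0 nt xt xn xh); exists w.
set f := 1%:M + t *m w => {}perm.
pose D := complexify (invmx S); pose ct := complexify t; pose cn := complexify n.
have DS : invmx (complexify S) = D by rewrite /D /complexify map_invmx.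
have Ds : D^T = D by rewrite /D /complexify matrix.map_trmx Si_sym.
have fE a : complexify f *m (a *: ct + cn) = (- a) *: ct + cn.
  rewrite mulmxDr -scalemxAr -!map_mxM mulmxDl mul1mx -mulmxA wt mul_mx_scalar.
  rewrite mulmxDl mul1mx -mulmxA wn mulmx0 addr0; congr (_ + _).
  by rewrite scaleNr scaler_nat mulr2n opprD addNKr map_mxN scalerN scaleNr.
have [y [yt yn _]] := pencil_solve n0 t0 nt xt xn xh 0 1%:M 0.
have comb0 a : a *: ct + cn != 0.
  apply/eqP => /(congr1 (mulmx (complexify y))).
  rewrite mulmxDr -scalemxAr -!map_mxM yt yn map_mx0 scaler0 add0r mulmx0 map_mx1.
  by move/eqP; rewrite oner_eq0.
have xcomb a : complexify x *m (a *: ct + cn) = 0.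
  by rewrite mulmxDr -scalemxAr -!map_mxM xt xn map_mx0 scaler0 addr0.
pose q u v := bilin D u^T v^T.
have qE a : is_tangent (complexify S) (a *: ct + cn) <->
    a ^+ 2 * q ct ct + 2 * a * q ct cn + q cn cn = 0.
  have v : bilin D (a *: ct + cn)^T (a *: ct + cn)^T =
      a ^+ 2 * q ct ct + 2 * a * q ct cn + q cn cn.
    rewrite [(_ + cn)^T]linearD /= [(_ *: ct)^T]linearZ /= !bilinE.
    by rewrite (bilinC cn^T ct^T Ds) /q; ring.
  rewrite is_tangentE // DS.
  have := bilin_eq0 D (a *: ct + cn)^T (a *: ct + cn)^T; rewrite trmxK v.
  by move=> e; split=> /eqP; [rewrite e|rewrite -e] => /eqP.
have q_real u v : q (complexify u) (complexify v) =
    real_complex R ((u^T *m invmx S *m v) 0 0).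
  by rewrite /q /bilin trmxK /D /complexify matrix.map_trmx -!map_mxM mxE.
have qtt : q ct ct != 0 by rewrite q_real fmorph_eq0 -mx11_eq0.
suff qtn : q ct cn = 0.
  move: qtn => /eqP; rewrite q_real fmorph_eq0 -mx11_eq0 => /eqP /(congr1 trmx).
  by rewrite trmx0 !trmx_mul trmxK Si_sym mulmxA.
apply: (linear_coef_eq0 (c := q cn cn) qtt) => a /qE.
by rewrite (perm _ (comb0 a) (xcomb a)) reflection_inv // fE => /qE.
Qed.
End PermutesTangents.

(** Here the field line and the tangent line are conjugate for the dual form D. Multiples of the
    dual of the billiard's own conic are excluded because every line field satisfies the condition
    for them. *)
Definition polar_form (R : realType) (B : conic_billiard R) (D : 'M[R]_3) : Prop :=
  [/\ D^T = D, forall k, D <> k *: invmx (conic B)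
    & forall x, curve B x -> (line_field B x)^T *m D *m tangent B x = 0].

(** * The diagonal matrices of the space forms *)

Section Diag.
Variable R : realType.

Lemma diag11_sym (c : R) : (diag11 c)^T = diag11 c.
Proof. exact: tr_diag_mx. Qed.

Lemma bilin_diag11 (c : R) (u v : 'rV[R]_3) :
  bilin (diag11 c) u v = u 0 0 * v 0 0 + u 0 1 * v 0 1 + c * u 0 ord_max * v 0 ord_max.
Proof.
rewrite /bilin mul_mx_diag mxE !big_ord_recl big_ord0 !mxE /= !addr0 !mulr1 addrA.
have -> : lift ord0 ord0 = 1 :> 'I_3 by exact: val_inj.
have -> : lift ord0 (lift ord0 ord0) = ord_max :> 'I_3 by exact: val_inj.
by rewrite (mulrC c).
Qed.

Lemma diag11_invol (c : R) : c ^+ 2 = 1 -> diag11 c *m diag11 c = 1%:M.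
Proof.
move=> c2; rewrite mulmx_diag -diag_const_mx; congr diag_mx.
by apply/rowP => i; rewrite !mxE; case: ifP => _; [rewrite -expr2|rewrite mulr1].
Qed.

Lemma diag11_neq0 (c : R) : diag11 c != 0.
Proof.
apply/eqP => /matrixP /(_ 0 0); rewrite !mxE eqxx mulr1n /= => /eqP.
by rewrite oner_eq0.
Qed.

Lemma diag110_nunit : diag11 (0 : R) \notin unitmx.
Proof.
rewrite unitmxE det_diag unitfE negbK; apply/prodf_eq0.
by exists ord_max => //; rewrite mxE eqxx.
Qed.
End Diag.

(** * Regular conics: signature, normal form and dual pencils *)

Section Regular.
Variable R : realType.
Implicit Types (K M S : 'M[R]_3).

(** An application of [punctured_conic_form_scale] without punctures; it trades equality of point
    sets for proportionality of matrices. *)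
Lemma regular_conic_points_eq M S : regular_conic M -> regular_conic S ->
  conic_points S = conic_points M <-> exists k, S = k *: M.
Proof.
move=> Mr [Ss Su [x0 Sx0]]; split=> [SM|[k Sk]].
  apply: (punctured_conic_form_scale (P := [::]) Mr Ss) => x [+ _].
  by rewrite -SM => -[].
have k0 : k != 0.
  apply/eqP => k0; move: Su; rewrite Sk k0 scale0r unitmxE det0 unitr0 //.
apply/funext => x; apply/propext; rewrite /conic_points Sk -scalemxAr -scalemxAl.
split=> -[-> /eqP h]; split=> //; apply/eqP.
  by move: h; rewrite scaler_eq0 (negbTE k0).
by rewrite (eqP h) scaler0.
Qed.

(** Along u + s v the form is a quadratic polynomial in s whose outer coefficients have opposite
    signs, hence with a real root. *)
Lemma indefinite_isotropic K (u v : 'rV[R]_3) : K^T = K ->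
  0 < bilin K u u -> bilin K v v < 0 ->
  exists2 z, z != 0 & bilin K z z = 0.
Proof.
move=> Ks; set a := bilin K u u; set b := bilin K u v; set c := bilin K v v => a0 c0.
pose r := Num.sqrt (b ^+ 2 - a * c).
have rr : r ^+ 2 = b ^+ 2 - a * c.
  by rewrite sqr_sqrtr // subr_ge0; apply: le_trans (sqr_ge0 b); nra.
pose s := (r - b) / c.
have zz : bilin K (u + s *: v) (u + s *: v) = 0.
  rewrite !bilinE (bilinC v u Ks) -/a -/b -/c.
  have -> : a = (b ^+ 2 - r ^+ 2) / c by rewrite rr; field; rewrite lt_eqF.
  by rewrite /s; field; rewrite lt_eqF.
(* If the vector were zero, u would be a multiple of v and could not have a positive value. *)
exists (u + s *: v) => //; apply/eqP => /(canRL (addrK _)); rewrite sub0r => uE.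
move: a0; rewrite /a uE -scaleNr !bilinE -/c; nra.
Qed.

Lemma regular_conic_signs M : regular_conic M ->
  exists u v, bilin M u u = 1 /\ bilin M v v = -1.
Proof.
move=> [Ms Mu [x Mx]].
have [d [e [c [xx xd de [ee xe dd c0 fu]]]]] := adapted_frame_exists Ms Mu Mx.
exists (x + 2^-1 *: e), (x + (- 2^-1) *: e).
by rewrite !bilinE (bilinC e x Ms) xx xe ee; split; field.
Qed.

(** The hyperbolic pair yields u and v of squares 1 and -1, and d is rescaled to a square equal to
    the sign of c. Placing the two vectors of equal sign first gives the matrix, with k that
    sign. *)
Lemma regular_conic_normal_form S : regular_conic S ->
  exists g (k : R), [/\ g \in unitmx, k != 0 & g *m S *m g^T = k *: diag11 (-1)].
Proof.
move=> [Ss Su [x Sx]].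
have [d [e [c [xx xd de [ee xe dd c0 fu]]]]] := adapted_frame_exists Ss Su Sx.
pose r := Num.sqrt `|c|; pose y := r^-1 *: d.
have r0 : r != 0 by rewrite sqrtr_eq0 -ltNge normr_gt0.
have rr : r * r = `|c| by rewrite -expr2 sqr_sqrtr.
pose u := x + 2^-1 *: e; pose v := x + (- 2^-1) *: e.
have ex : bilin S e x = 1 by rewrite bilinC.
have ed : bilin S e d = 0 by rewrite bilinC.
have uu : bilin S u u = 1 by rewrite !bilinE ex xx xe ee; field.
have vv : bilin S v v = -1 by rewrite !bilinE ex xx xe ee; field.
have uv : bilin S u v = 0 by rewrite !bilinE ex xx xe ee; field.
have yu : bilin S y u = 0 by rewrite !bilinE (bilinC d x Ss) xd de; ring.
have yv : bilin S y v = 0 by rewrite !bilinE (bilinC d x Ss) xd de; ring.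
have yy : bilin S y y = c / `|c|.
  by rewrite !bilinE dd -rr; field.
have main (p q : 'rV[R]_3) (k : R) : bilin S y p = 0 -> bilin S y q = 0 ->
    bilin S p q = 0 -> bilin S y y = k -> bilin S p p = k -> bilin S q q = - k ->
    frame y p q *m S *m (frame y p q)^T = k *: diag11 (-1).
  move=> yp yq pq yk pk qk; apply/matrixP => i j; rewrite frame_gram !rowK !mxE.
  case: i => [[|[|[|//]]] ?]; case: j => [[|[|[|//]]] ?];
    rewrite /= ?mulr1n ?mulr0n ?mulr0 ?mulr1 ?mulrN1 //; by rewrite bilinC.
have unit (g : 'M[R]_3) (k : R) : k != 0 -> g *m S *m g^T = k *: diag11 (-1) ->
    g \in unitmx.
  move=> k0 gS; have : g *m (S *m g^T *m (k^-1 *: diag11 (-1))) = 1%:M.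
    rewrite !mulmxA gS -scalemxAl -scalemxAr scalerA divff // scale1r.
    by rewrite diag11_invol // sqrrN expr1n.
  by case/mulmx1_unit.
have [cp|cn|c00] := ltgtP c 0; last by move: c0; rewrite c00 eqxx.
- have E := main v u (-1) yv yu; exists (frame y v u), (-1).
  have {}E : frame y v u *m S *m (frame y v u)^T = -1 *: diag11 (-1).
    by apply: E; rewrite ?opprK ?uu ?vv ?yy // 1?bilinC // ltr0_norm // invrN mulrN divff.
  have kn : -1 != 0 :> R by rewrite oppr_eq0 oner_eq0.
  by split=> //; exact: (unit _ _ kn E).
- have E : frame y u v *m S *m (frame y u v)^T = 1 *: diag11 (-1).
    by apply: main; rewrite ?uu ?vv ?yy // gtr0_norm // divff.
  exists (frame y u v), 1; split=> //; first exact: (unit _ _ (oner_neq0 R) E).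
Qed.

(** For large l the term in M^-1 dominates at one positive and one negative vector, so the sum is
    indefinite; it is invertible once l avoids finitely many values. *)
Lemma dual_pencil_regular M D : regular_conic M -> D^T = D ->
  exists l S, regular_conic S /\ invmx S = D + l *: invmx M.
Proof.
move=> Mr Ds; have [Ms Mu _] := Mr.
have Mis : (invmx M)^T = invmx M by rewrite trmx_inv Ms.
have [u [v [uu vv]]] := regular_conic_signs Mr.
have bM K (z : 'rV_3) : bilin K (z *m M) (z *m M) = bilin (M *m K *m M) z z.
  by rewrite bilin_mull bilin_mulr Ms.
pose a := bilin D (u *m M) (u *m M); pose b := bilin D (v *m M) (v *m M).
have [l [la lb lD]] : exists l, [/\ - a < l, b < l & D + l *: invmx M \in unitmx].
  (* Since M (D + l M^-1) = l - N, only eigenvalues of N must be avoided; l is taken above all of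
     them and above |a| and |b|. *)
  pose N := - (M *m D).
  pose rs := [:: `|a|, `|b| & rootsR (char_poly N)].
  pose l := 1 + \sum_(r <- rs) `|r|.
  have lr r : r \in rs -> r < l.
    move=> rr; rewrite /l (big_rem r) //=.
    have : 0 <= \sum_(y <- rem r rs) `|y| by apply: sumr_ge0.
    have := ler_norm r; lra.
  exists l; split.
  - by apply: le_lt_trans (lr `|a| _); rewrite ?inE ?eqxx // -normrN ler_norm.
  - by apply: le_lt_trans (lr `|b| _); rewrite ?inE ?eqxx ?orbT // ler_norm.
  - have : ~~ root (char_poly N) l.
      apply/negP => rl; have : l < l; last by rewrite ltxx.
      apply: lr; rewrite !inE -(roots_on_rootsR (monic_neq0 (char_poly_monic N))).
      by rewrite in_itv /= rl !orbT.
    rewrite -eigenvalue_root_char => ev.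
    have Nu : N - l%:M \in unitmx.
      by rewrite -row_free_unit -kermx_eq0; move: ev; rewrite /eigenvalue negbK.
    have : M *m (D + l *: invmx M) \in unitmx.
      rewrite (_ : _ *m _ = (-1) *: (N - l%:M)); last first.
        by rewrite mulmxDr -scalemxAr mulmxV // scalemx1 scaleN1r opprB opprK addrC.
      by rewrite unitmxZ // unitrN1.
    by rewrite unitmx_mul Mu.
have Es : (D + l *: invmx M)^T = D + l *: invmx M.
  by rewrite linearD linearZ /= Ds Mis.
have bE z : bilin (D + l *: invmx M) (z *m M) (z *m M) =
    bilin D (z *m M) (z *m M) + l * bilin M z z.
  by rewrite bilinDmx bilinZmx (bM (invmx M)) mulmxV // mul1mx.
have [z z0 zz] : exists2 z, z != 0 & bilin (D + l *: invmx M) z z = 0.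
  apply: (@indefinite_isotropic _ (u *m M) (v *m M)) => //.
    by rewrite bE uu -/a; lra.
  by rewrite bE vv -/b; lra.
exists l, (invmx (D + l *: invmx M)); split; last by rewrite invmxK.
split; [by rewrite trmx_inv Es|by rewrite unitmx_inv|].
(* The dual form carries its isotropic row z to a point of the conic of the inverse matrix. *)
exists (z *m (D + l *: invmx M)); split.
  apply: contra_neq z0 => /(congr1 (mulmx^~ (invmx (D + l *: invmx M)))).
  by rewrite mulmxK // mul0mx.
by apply/eqP; rewrite bilin_eq0 bilin_mull bilin_mulr Es mulmxV // mul1mx zz.
Qed.
End Regular.

(** * Conjugacy of tangent and field lines along a billiard *)

Section Billiards.
Variable R : realType.
Implicit Types (B : conic_billiard R) (D S A : 'M[R]_3).

Lemma orthogonal_proportional m (D : 'M[R]_m) (n n' t t' : 'cV[R]_m) :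
  proportional n n' -> proportional t t' ->
  n'^T *m D *m t' = 0 -> n^T *m D *m t = 0.
Proof.
move=> [k _ ->] [l _ ->] h.
by rewrite [(k *: n')^T]linearZ /= -!scalemxAl -scalemxAr h !scaler0.
Qed.

Lemma proportional_refl m n (A : 'M[R]_(m, n)) : proportional A A.
Proof. by exists 1; rewrite ?oner_neq0 ?scale1r. Qed.

Lemma proportional_mull m n p (g : 'M[R]_(m, n)) (u v : 'M[R]_(n, p)) :
  proportional u v -> proportional (g *m u) (g *m v).
Proof. by move=> [k k0 ->]; exists k; rewrite // -scalemxAr. Qed.

Lemma proportional_mulr m n p (g : 'M[R]_(n, p)) (u v : 'M[R]_(m, n)) :
  proportional u v -> proportional (u *m g) (v *m g).
Proof. by move=> [k k0 ->]; exists k; rewrite // -scalemxAl. Qed.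

Lemma billiard_lines B x : curve B x ->
  [/\ x *m tangent B x = 0, tangent B x != 0, x *m line_field B x = 0,
      line_field B x != 0 & ~ proportional (line_field B x) (tangent B x)].
Proof.
move=> Cx; have [Mr [/(_ x Cx) [N0 xN nt] _ _]] := (conic_regular B, field_transversal B).
have [[Ms Mu _] [[x0 xMx] _]] := (Mr, Cx).
split=> //; first by rewrite mulmxA.
apply: contra_neq x0 => /(congr1 (mulmx (invmx (conic B)))).
by rewrite mulKmx // mulmx0 => /(congr1 trmx); rewrite trmxK trmx0.
Qed.

(* The polar condition is closed on the curve, and the curve meets the locus
   where the tangent line is isotropic for D in a finite set. *)
Lemma polar_form_of_generic B D : D^T = D ->
  (forall k, D <> k *: invmx (conic B)) ->
  (forall x, curve B x -> (tangent B x)^T *m D *m tangent B x != 0 ->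
    (line_field B x)^T *m D *m tangent B x = 0) ->
  polar_form B D.
Proof.
move=> Ds Dn gen; split=> // x Cx.
have [Ms Mu _] := conic_regular B; have [Mx _] := Cx.
(* The value of K at x is the value of D at the tangent line M x^T. *)
pose M := conic B; pose K := M *m D *m M.
have Ks : K^T = K by rewrite /K !trmx_mul Ds Ms mulmxA.
have Kn k : K <> k *: M.
  move=> KM; apply: (Dn k); have := congr1 (fun X => invmx M *m X *m invmx M) KM.
  rewrite /K !mulmxA mulVmx // mul1mx mulmxK // => ->.
  by rewrite -scalemxAr mulVmx // -scalemxAl mul1mx.
have [p [px pC /(_ K Ks Kn) pK]] := punctured_conic_near (punctures B) Ms Mu Mx.
have [_ _ /(_ x Cx) [n [nN ncont]]] := field_transversal B.
(* For small s the points p(s) stay on the curve, so they approach x in the sense required by the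
   continuity of n. *)
have pW : p @ 0^' --> within (curve B) (nbhs x).
  move=> U /px /= pU.
  have {}pU : \forall s \near 0^', curve B (p s) -> U (p s) by exact: pU.
  suff : \forall s \near 0^', U (p s) by [].
  near=> s; have : curve B (p s) by near: s.
  by near: s.
have np : (fun s => n (p s)) @ 0^' --> n x by apply: cvg_comp pW ncont.
have lim : (fun s => (n (p s))^T *m D *m (M *m (p s)^T)) @ 0^' -->
    (n x)^T *m D *m (M *m x^T).
  apply: cvg_mulmx; first by apply: cvg_mulmx; [exact: cvg_trmx|exact: cvg_cst].
  by apply: cvg_mulmx; [exact: cvg_cst|exact: cvg_trmx].
(* Near x, but away from s = 0, the tangent lines are not isotropic for D, so [gen] makes the
   expression vanish; its limit is then 0. *)
have lim0 : (fun s => (n (p s))^T *m D *m (M *m (p s)^T)) @ 0^' --> (0 : 'M[R]_1).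
  apply: cvg_near_cst; near=> s.
  have Cs : curve B (p s) by near: s.
  apply: orthogonal_proportional (nN _ Cs) (proportional_refl _) _.
  apply: gen => //; rewrite /tangent /tangent_line trmx_mul trmxK Ms -/M !mulmxA.
  have : p s *m K *m (p s)^T != 0 by near: s.
  by rewrite /K !mulmxA.
have n0 : (n x)^T *m D *m tangent B x = 0 by exact: (cvg_unique _ lim lim0).
have [k k0 nk] := nN x Cx.
have {}nk : proportional (line_field B x) (n x).
  by exists k^-1; rewrite ?invr_eq0 // nk scalerA mulVf // scale1r.
exact: orthogonal_proportional nk (proportional_refl _) n0.
Unshelve. all: by end_near. Qed.

(** With t = M x^T, the added term is a multiple of n^T x^T, which is zero because n passes through
    x. *)
Lemma polar_form_pencil B D (l : R) : polar_form B D ->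
  polar_form B (D + l *: invmx (conic B)).
Proof.
move=> [Ds Dn orth]; have [Ms Mu _] := conic_regular B; split.
- by rewrite linearD linearZ /= Ds trmx_inv Ms.
- move=> k /(canRL (addrK _)); rewrite -scalerBl; exact: Dn.
- move=> x Cx; rewrite mulmxDr mulmxDl orth // add0r -scalemxAr -scalemxAl.
  rewrite /tangent /tangent_line mulmxA mulmxKV //.
  have [_ _ xN _ _] := billiard_lines Cx.
  by rewrite -trmx_mul xN trmx0 scaler0.
Qed.

(** As A is an involution, t^T A is an A-normal of the plane t; the hypothesis is tested on it. *)
Lemma orthogonal_planes_polar A (t n : 'cV[R]_3) : A^T = A -> A *m A = 1%:M ->
  orthogonal_planes A t n -> n^T *m A *m t = 0.
Proof.
move=> As AA /(_ (t^T *m A)) h.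
have /h : forall u : 'rV_3, u *m t = 0 -> u *m A *m (t^T *m A)^T = 0.
  by move=> u ut; rewrite trmx_mul trmxK As mulmxA -(mulmxA u) AA mulmx1.
by move=> /(congr1 trmx); rewrite trmx0 !trmx_mul trmxK As mulmxA.
Qed.

Lemma mulmx_tr_eq0 m (r : 'rV[R]_m) : r *m r^T = 0 -> r = 0.
Proof.
move=> /matrixP /(_ 0 0); rewrite !mxE => /eqP; rewrite psumr_eq0; last first.
  by move=> k _; rewrite mxE -expr2 sqr_ge0.
move=> /allP h; apply/matrixP => i j; rewrite ord1 [RHS]mxE.
by have := h j (mem_index_enum _); rewrite mxE mulf_eq0 orbb => /eqP.
Qed.

Lemma polar_orthogonal_planes A (t n : 'cV[R]_3) : A^T = A -> A *m A = 1%:M ->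
  t != 0 -> n^T *m A *m t = 0 -> orthogonal_planes A t n.
Proof.
move=> As AA t0 nAt v h.
have tt : (t^T *m t) 0 0 != 0.
  rewrite -mx11_eq0; apply: contra_neq t0 => tt; apply: (can_inj (@trmxK _ _ _)).
  by rewrite trmx0; apply: mulmx_tr_eq0; rewrite trmxK.
(* d is the part of v A that is Euclidean-orthogonal to t^T. It lies in the plane t, so the
   hypothesis on v makes it orthogonal to itself; hence v is a multiple of t^T A. *)
pose k := (v *m A *m t) 0 0 / (t^T *m t) 0 0; pose d := v *m A - k *: t^T.
have dt : d *m t = 0.
  rewrite mulmxBl -scalemxAl [v *m A *m t]mx11_scalar [t^T *m t]mx11_scalar.
  by rewrite scale_scalar_mx divfK // subrr.
have /mulmx_tr_eq0 /eqP : d *m d^T = 0.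
  rewrite {2}/d [(_ - _)^T]linearB /= [(k *: _)^T]linearZ /= trmxK mulmxBr.
  by rewrite -scalemxAr dt scaler0 subr0 trmx_mul As mulmxA h.
rewrite subr_eq0 => /eqP vA.
rewrite -[v]mulmx1 -AA mulmxA vA -!scalemxAl.
move: nAt => /(congr1 trmx); rewrite trmx0 !trmx_mul trmxK As mulmxA => ->.
by rewrite scaler0.
Qed.
End Billiards.

(** * Space forms, projective equivalence and permuted tangents *)

Lemma invmx_multiple (F : fieldType) n (M S : 'M[F]_n) :
  M \in unitmx -> S \in unitmx ->
  (exists k, S = k *: M) -> exists k, invmx S = k *: invmx M.
Proof. by move=> Mu Su [k kE]; exists k^-1; rewrite {1}kE invmxZ // -kE. Qed.

Section Equivalence.
Variable R : realType.
Implicit Types (B : conic_billiard R) (D S A : 'M[R]_3).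

Lemma conic_points_neq_invmx B S : regular_conic S ->
  (conic_points S <> conic_points (conic B)) <->
  (forall k, invmx S <> k *: invmx (conic B)).
Proof.
move=> Sr; have [[_ Mu _] [_ Su _]] := (conic_regular B, Sr).
have eqE := regular_conic_points_eq (conic_regular B) Sr.
split=> [h k kE|h /eqE /(invmx_multiple Mu Su) [k kE]]; last exact: (h k).
apply/h/eqE; rewrite -[S]invmxK -[conic B]invmxK.
by apply: invmx_multiple; rewrite ?unitmx_inv //; exists k.
Qed.

Lemma orthogonal_columns_diag11 (c : R) (n t : 'cV[R]_3) :
  (n^T *m diag11 c *m t == 0) =
  (n 0 0 * t 0 0 + n 1 0 * t 1 0 + c * n ord_max 0 * t ord_max 0 == 0).
Proof. by rewrite -[t in LHS]trmxK bilin_eq0 bilin_diag11 !mxE. Qed.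

(** If diag(1,1,1) or diag(1,1,-1) were a multiple of the dual conic, the whole curve would lie on
    the absolute; diag(1,1,0) is singular, hence no such multiple. *)
Lemma space_form_polar A B : space_form_billiard A B -> polar_form B A.
Proof.
have [_ Mu _] := conic_regular B.
case=> [[-> sf]|[Ac [[y [My _] yA] sf]]]; last first.
  have [As AA] : A^T = A /\ A *m A = 1%:M.
    by case: Ac => ->; split; rewrite ?diag11_sym ?diag11_invol ?sqrrN ?expr1n.
  split=> // [k AM|x Cx]; last exact: orthogonal_planes_polar (sf x Cx).
  have MA : conic B = k *: A.
    by rewrite -[LHS]mulmx1 -AA {1}AM -scalemxAl -scalemxAr mulmxA mulmxV // mul1mx.
  have k0 : k != 0.
    apply: contra_eqT MA => /negPn/eqP ->; rewrite scale0r.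
    by apply: contraTneq Mu => ->; rewrite unitmxE det0 unitr0.
  move/eqP: yA; apply; case: My => _ /eqP.
  by rewrite MA -scalemxAr -scalemxAl scaler_eq0 (negbTE k0) => /eqP.
split=> [|k AM|x Cx]; first exact: diag11_sym.
  have k0 : k != 0.
    by apply/eqP => k0; move: (diag11_neq0 (0 : R)); rewrite AM k0 scale0r eqxx.
  by have := diag110_nunit R; rewrite AM unitmxZ ?unitfE // unitmx_inv Mu.
have [_] := sf x Cx; set t := tangent B x; set n := line_field B x => perp.
(* A direction vector of the affine line l in the plane x_3 = 1: its normal (l_0, l_1) turned by a
   right angle. *)
pose rot (l : 'cV[R]_3) : 'rV[R]_3 :=
  \row_j if j == 0 then - l 1 0 else if j == 1 then l 0 0 else 0.
have rotl l : rot l *m l = 0.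
  apply/eqP; rewrite mx11_eq0 mxE !big_ord_recl big_ord0 !mxE /=.
  have -> : lift ord0 ord0 = 1 :> 'I_3 by exact: val_inj.
  by apply/eqP; ring.
have := perp (rot t) (rot n); rewrite !rotl => /(_ _ _ erefl erefl) h.
apply/eqP; rewrite orthogonal_columns_diag11 !mul0r addr0.
have {h} : rot t *m (rot n)^T = 0 by apply: h; rewrite mxE.
move=> /eqP; rewrite mx11_eq0 mxE !big_ord_recl big_ord0 !mxE /=.
move=> /eqP h; apply/eqP; rewrite -[RHS]h; ring.
Qed.

(** Lines transform by g^-1, so D is pulled back to (g^-1)^T D g^-1. *)
Lemma polar_form_equivalent B B' D :
  projectively_equivalent B B' -> polar_form B' D -> exists D', polar_form B D'.
Proof.
move=> [g [gu CC NN]] [Ds Dn orth].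
have [[Ms Mu _] [Ms' Mu' _]] := (conic_regular B, conic_regular B').
(* The pulled back conic vanishes on the curve of B, hence is a multiple of its conic; tangent lines
   then correspond up to that factor. *)
have [k kE] : exists k, g *m conic B' *m g^T = k *: conic B.
  apply: (punctured_conic_form_scale (P := punctures B) (conic_regular B)).
    by rewrite !trmx_mul trmxK Ms' mulmxA.
  by move=> x /CC [[_]]; rewrite trmx_mul !mulmxA.
have gTu : g^T \in unitmx by rewrite unitmx_tr.
have k0 : k != 0.
  apply/eqP => k0; have : g *m conic B' *m g^T \in unitmx by rewrite !unitmx_mul gu Mu'.
  by rewrite kE k0 scale0r unitmxE det0 unitr0.
have gM : conic B' *m g^T = k *: (invmx g *m conic B).
  by rewrite scalemxAr -kE !mulmxA mulVmx // mul1mx.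
pose D' := (invmx g)^T *m D *m invmx g.
exists D'; split.
- by rewrite /D' !trmx_mul trmxK Ds mulmxA.
- move=> l DE; apply: (Dn (l * k)).
  have {}DE : D = l *: (g^T *m invmx (conic B) *m g).
    have := congr1 (fun X => g^T *m X *m g) DE.
    rewrite /D' !mulmxA -trmx_mul mulVmx // trmx1 mul1mx mulmxKV // => ->.
    by rewrite -scalemxAr -scalemxAl.
  have : D *m conic B' = (l * k)%:M.
    apply: (can_inj (mulmxK gTu)); rewrite -mulmxA gM DE -scalemxAl -scalemxAr.
    by rewrite !mulmxA mulmxK // mulmxKV // scalerA mul_scalar_mx.
  move=> /(congr1 (mulmx^~ (invmx (conic B')))).
  by rewrite mulmxK // mul_scalar_mx.
- move=> x Cx; have := orth _ (proj1 (CC x) Cx).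
  have [l l0 ->] := NN x Cx.
  rewrite /tangent /tangent_line trmx_mul (mulmxA (conic B')) gM [(l *: _)^T]linearZ /=.
  rewrite -!scalemxAl -!scalemxAr => /eqP.
  rewrite !scaler_eq0 (negbTE k0) (negbTE l0) /= => /eqP.
  by rewrite /D' trmx_mul !mulmxA.
Qed.

(** The image of B under y -> y g^-1: all data are pulled back along y -> y g, and linearity and
    invertibility preserve transversality and continuity. *)
Lemma conic_billiard_transport B (g : 'M[R]_3) : g \in unitmx ->
  exists B', [/\ conic B' = g *m conic B *m g^T,
    forall y, curve B' y <-> curve B (y *m g)
    & forall y, line_field B' y = g *m line_field B (y *m g)].
Proof.
move=> gu; have Mr := conic_regular B; have [Ms Mu [x0 [x00 Mx0]]] := Mr.
have gTu : g^T \in unitmx by rewrite unitmx_tr.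
pose M' := g *m conic B *m g^T.
pose P' := [seq q *m invmx g | q <- punctures B].
pose N' y := g *m line_field B (y *m g).
have nz m (u : 'M[R]_(m, 3)) : (u *m g == 0) = (u == 0).
  apply/eqP/eqP => [|->]; last by rewrite mul0mx.
  by move=> /(congr1 (mulmx^~ (invmx g))); rewrite mulmxK // mul0mx.
have pts y : conic_points M' y <-> conic_points (conic B) (y *m g).
  by rewrite /conic_points nz /M' trmx_mul !mulmxA.
have crv y : punctured_conic M' P' y <-> curve B (y *m g).
  rewrite /curve /punctured_conic /=; split=> -[/pts My Py]; split=> //.
    move=> q qP yq; apply: (Py (q *m invmx g)); first exact: map_f.
    by rewrite -[y](mulmxK gu); exact: proportional_mulr.
  move=> _ /mapP [q qP ->] yq; apply: (Py q qP).
  by rewrite -[q](mulmxKV gu); exact: proportional_mulr.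
have Mr' : regular_conic M'.
  split; [by rewrite !trmx_mul trmxK Ms mulmxA|by rewrite !unitmx_mul gu gTu Mu|].
  by exists (x0 *m invmx g); apply/pts; rewrite mulmxKV.
have Nt : transversal_line_field M' (punctured_conic M' P') N'.
  split.
  - move=> y /crv Cy; have [_ t0 xN N0 nt] := billiard_lines Cy.
    split; first last.
    + have -> : tangent_line M' y = g *m tangent B (y *m g).
        by rewrite /M' /tangent /tangent_line trmx_mul !mulmxA.
      by move=> /(proportional_mull (invmx g)); rewrite !mulKmx.
    + by rewrite /N' mulmxA.
    + by apply: contra_neq N0 => /(congr1 (mulmx (invmx g))); rewrite mulKmx // mulmx0.
  - move=> y k /crv Cy k0; rewrite /N' -scalemxAl; apply: proportional_mull.
    by have [_ hom _] := field_transversal B; exact: hom.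
  - move=> y /crv Cy; have [_ _ /(_ _ Cy) [n [nN ncont]]] := field_transversal B.
    exists (fun z => g *m n (z *m g)); split=> [z /crv Cz|].
      by apply: proportional_mull; exact: nN.
    apply: cvg_mulmx; first exact: cvg_cst.
    have gW : (fun z : 'rV[R]_3 => z *m g) @ within (punctured_conic M' P') (nbhs y) -->
        within (curve B) (nbhs (y *m g)).
      move=> U; rewrite /within /= => CU.
      have gc : (fun z : 'rV[R]_3 => z *m g) @ y --> y *m g.
        apply: (@cvg_mulmx R _ _ (nbhs_filter y) 1 3 3 id (fun=> g) y g) => //.
        exact: cvg_cst.
      have := gc _ CU; rewrite /= !nbhs_simpl /=.
      by apply: filterS => z hz /crv /hz.
    exact: cvg_comp gW ncont.
by exists (ConicBilliard Mr' Nt).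
Qed.

(** The frame that brings S to a multiple of A = diag(1,1,-1) also brings S^-1 to a multiple of A,
    so moving the billiard turns conjugacy for S^-1 into orthogonality for A. *)
Lemma polar_space_form B S : regular_conic S -> polar_form B (invmx S) ->
  exists A B', space_form_billiard A B' /\ projectively_equivalent B B'.
Proof.
move=> Sr [Sis Sn orth]; have [Ss Su _] := Sr.
have [g [k [gu k0 gS]]] := regular_conic_normal_form Sr.
have gTu : g^T \in unitmx by rewrite unitmx_tr.
pose A := diag11 (-1 : R).
have As : A^T = A by exact: diag11_sym.
have AA : A *m A = 1%:M by rewrite diag11_invol // sqrrN expr1n.
have SA : g^T *m A *m g = k *: invmx S.
  apply: (can_inj (mulmxK Su)); rewrite -scalemxAl mulVmx //.
  apply: (can_inj (mulmxK gTu)); rewrite -(mulmxA _ S) -(mulmxA _ g) (mulmxA g) gS.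
  by rewrite -scalemxAr -(mulmxA _ A) AA mulmx1 -scalemxAl mul1mx.
have [B' [MB' CB' NB']] := conic_billiard_transport B gu.
exists A, B'; split; last first.
  exists (invmx g); split; first by rewrite unitmx_inv.
    by move=> x; rewrite CB' mulmxKV.
  by move=> x Cx; rewrite invmxK NB' mulmxKV //; exact: proportional_refl.
right; split; first by right.
split.
  (* Were the moved curve contained in the absolute, S would vanish on the curve of B and be a
     multiple of its conic. *)
  apply: contrapT => h; have [j jE] : exists j, S = j *: conic B.
    apply: (punctured_conic_form_scale (P := punctures B) (conic_regular B) Ss).
    move=> x Cx; apply: contrapT => /eqP xS; apply: h; exists (x *m invmx g).
      by apply/CB'; rewrite mulmxKV.
    apply: contraNneq xS => xA.
    rewrite -[S](mulKmx gu) -[g *m S](mulmxK gTu) gS.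
    rewrite -scalemxAl -!scalemxAr -scalemxAl scaler_eq0; apply/orP; right.
    by rewrite -xA trmx_mul !mulmxA trmx_inv.
  have [_ Mu _] := conic_regular B.
  have [j' j'E] := invmx_multiple Mu Su (ex_intro _ j jE).
  exact: Sn j'E.
move=> y /CB' Cy; have [_ t0 _ _ _] := billiard_lines Cy.
have tB : tangent B' y = g *m tangent B (y *m g).
  by rewrite /tangent /tangent_line MB' trmx_mul !mulmxA.
apply: polar_orthogonal_planes => //.
  rewrite tB; apply: contra_neq t0 => /(congr1 (mulmx (invmx g))).
  by rewrite mulKmx // mulmx0.
rewrite tB NB' trmx_mul (mulmxA _ g) -(mulmxA _ _ g) -(mulmxA _ g^T) (mulmxA g^T) SA.
by rewrite -scalemxAr -scalemxAl orth // scaler0.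
Qed.

(** Left to right is pointwise. Conversely the reflection yields conjugacy only where the tangent
    line is not tangent to S, and [polar_form_of_generic] fills in the other points. *)
Lemma polar_permutes_tangents B S : regular_conic S ->
  polar_form B (invmx S) <->
  (conic_points S <> conic_points (conic B) /\
   forall (x : 'rV[R]_3) (h : 'cV[R]_3) (f : 'M[R]_3),
     curve B x -> x *m h != 0 ->
     billiard_reflection h x (tangent B x) (line_field B x) f ->
     permutes_tangents S x f).
Proof.
move=> Sr; have [Ss Su _] := Sr.
split=> [[_ Sn orth]|[SM perm]].
  split=> [|x h f Cx xh xf]; first exact/conic_points_neq_invmx.
  have [xt t0 xN N0 nt] := billiard_lines Cx.
  exact: (orthogonal_permutes_tangents Ss Su N0 t0 nt xt xN xh (orth _ Cx) xf).
apply: polar_form_of_generic; [by rewrite trmx_inv Ss|exact/conic_points_neq_invmx|].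
move=> x Cx tSt; have [xt t0 xN N0 nt] := billiard_lines Cx.
(* Over the reals the line x^T misses x, so it can serve as the line at infinity h. *)
have xx : x *m x^T != 0.
  by have [[x0 _] _] := Cx; apply: contra_neq x0; exact: mulmx_tr_eq0.
apply: (permutes_tangents_orthogonal Ss Su N0 t0 nt xt xN xx tSt) => f.
exact: perm.
Qed.
End Equivalence.

Theorem proposition1p27 (R : realType) (B : conic_billiard R) :
  (exists (A : 'M[R]_3) (B' : conic_billiard R),
     space_form_billiard A B' /\ projectively_equivalent B B')
  <->
  (exists S : 'M[R]_3,
     [/\ regular_conic S,
         conic_points S <> conic_points (conic B)
       & forall (x : 'rV[R]_3) (h : 'cV[R]_3) (f : 'M[R]_3),
           curve B x -> x *m h != 0 ->
           billiard_reflection h x (tangent B x) (line_field B x) f ->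
           permutes_tangents S x f]).
Proof.
split=> [[A [B' [/space_form_polar AB' BB']]]|[S [Sr SM perm]]].
  have [D DB] := polar_form_equivalent BB' AB'.
  have [Ds _ _] := DB.
  (* D need not be the dual of a regular conic, so it is first moved within its pencil with the dual
     of the billiard's conic. *)
  have [l [S [Sr SE]]] := dual_pencil_regular (conic_regular B) Ds.
  have := polar_form_pencil l DB; rewrite -SE.
  move=> /(polar_permutes_tangents B Sr) [SM perm].
  by exists S.
by apply: (polar_space_form Sr); apply/(polar_permutes_tangents B Sr).
Qed.
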